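(* Let $n\ge 1$, let $\mathbb{F}$ be a field, let $1\le m\le n-1$, and let $\alpha$ be an anti-chain of size $m$ in $[n]\times[m]$. Then the association scheme $\mathfrak{X}_\alpha=(\mathcal{O}_\alpha,\{\mathcal{R}_{\alpha,\beta}\}_\beta)$ ($\beta$ ranging over anti-chains in $\mathcal{D}(\alpha)$) is the generalized wreath product of the one-class association schemes with base set $\mathbb{F}$ over the poset $\mathcal{D}(\alpha)$. Concretely: the map $M\mapsto (M_{i,j})_{(i,j)\in\mathcal{D}(\alpha)}$ is a bijection $\mathcal{O}_\alpha\to\mathbb{F}^{\mathcal{D}(\alpha)}$, and for every anti-chain $\beta$ in $\mathcal{D}(\alpha)$ and all $M,N\in\mathcal{O}_\alpha$ we have $(M,N)\in\mathcal{R}_{\alpha,\beta}$ if and only if $M_{i,j}=N_{i,j}$ for all $(i,j)\in\mathcal{D}(\alpha)\setminus(\beta\cup\mathrm{Down}(\beta))$ and $M_{i,j}\ne N_{i,j}$ for all $(i,j)\in\beta$; i.e. this bijection carries each $\mathcal{R}_{\alpha,\beta}$ onto the relation $R(\beta,(1)_{x\in\beta})$ of the generalized wreath product.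
   Context: $[k]=\{1,\dots,k\}$. A matrix in $\mathrm{Mat}_n(\mathbb{F})$ is in reduced reverse column echelon form if: (CE1) any zero columns lie to the right of all nonzero columns; (CE2) the last (lowest) nonzero entry of a nonzero column lies strictly below the last nonzero entry of the column immediately to its right (whenever that column is nonzero); (CE3) every last nonzero entry of a nonzero column equals $1$ and is the only nonzero entry in its row. Order $[n]\times[n]$ by $(i,j)\le(k,l)$ iff $i\le k$ and $j\le l$; an anti-chain is a set of pairwise incomparable elements; for an anti-chain $Y$ in a poset, $\mathrm{Down}(Y)=\{x: x<y\text{ for some } y\in Y\}$ (strict). $\mathrm{Piv}(M)$ is the set of maximal elements of $\{(i,j):M_{i,j}\neq0\}$. $\mathcal{O}_\alpha$ is the set of reduced reverse column echelon matrices $M$ with $\mathrm{Piv}(M)=\alpha$. $\mathcal{D}(\alpha)=\{(i,j)\in\mathrm{Down}(\alpha):\text{there is no } k\text{ with }(i,k)\in\alpha\}$, with the induced order. For an anti-chain $\beta\subseteq\mathcal{D}(\alpha)$, $\mathcal{R}_{\alpha,\beta}=\{(M,N)\in\mathcal{O}_\alpha\times\mathcal{O}_\alpha:\mathrm{Piv}(M-N)=\beta\}$. The one-class association scheme on a set $\Omega$ has relations $R_0=\{(\omega,\omega)\}$ and $R_1=\{(\omega,\omega'):\omega\ne\omega'\}$. Generalized wreath product (Bailey): given a finite poset $X$ and for each $x\in X$ an $r_x$-class association scheme on $\Omega_x$ with relations $R_{x,0}$ (diagonal), $R_{x,1},\dots,R_{x,r_x}$, its base set is $\Omega=\prod_{x\in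 X}\Omega_x$ and its relations are, for each anti-chain $Y\subseteq X$ and each $(i_x)_{x\in Y}$ with $1\le i_x\le r_x$, the set $R(Y,(i_x))$ of pairs $((a_x),(b_x))\in\Omega\times\Omega$ with $a_x=b_x$ for $x\in X\setminus(Y\cup\mathrm{Down}(Y))$ and $(a_x,b_x)\in R_{x,i_x}$ for $x\in Y$. *)

(* Defs.v *)
From HB Require Import structures.
From mathcomp Require Import all_boot all_order all_algebra.

Set Implicit Arguments.
Unset Strict Implicit.
Unset Printing Implicit Defensive.

Import Order.TTheory GRing.Theory.

Section Posets.
Local Open Scope order_scope.
Context {d : Order.disp_t} {X : finPOrderType d}.
Implicit Types Y : {set X}.

Definition antichain Y : bool :=
  [forall x in Y, forall y in Y, (x != y) ==> (x >< y)].

Definition Down Y : {set X} := [set x | [exists y in Y, x < y]].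

Definition maxelems Y : {set X} := [set x in Y | [forall y in Y, ~~ (x < y)]].

End Posets.

Section WreathProduct.
Context {d : Order.disp_t} {X : finPOrderType d}.
Variables (r : X -> nat) (Omega : X -> Type).
Variable R : forall x, 'I_(r x).+1 -> Omega x -> Omega x -> Prop.

(* A relation of the generalized wreath product is labelled by an anti-chain Y
   and indices (i_x) for x in Y with 1 <= i_x <= r_x.  The family i is total
   here, but only its values on Y are constrained or used. *)
Definition wreath_label (Y : {set X}) (i : forall x, 'I_(r x).+1) : Prop :=
  antichain Y /\ (forall x, x \in Y -> i x != ord0).

Definition wreath_rel (Y : {set X}) (i : forall x, 'I_(r x).+1)
    (a b : {dffun forall x, Omega x}) : Prop :=
  (forall x, x \notin Y :|: Down Y -> a x = b x) /\
  (forall x, x \in Y -> R (i x) (a x) (b x)).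

End WreathProduct.

Definition one_class_rel (T : Type) (i : 'I_2) (a b : T) : Prop :=
  if i == ord0 then a = b else a <> b.

(* The product order on positions: (i, j) <= (k, l) iff i <= k and j <= l.
   Indices are 0-based. *)
Notation pos n := ('I_n *p 'I_n)%type.

Section EchelonForms.
Local Open Scope ring_scope.
Context {F : fieldType} {n : nat}.
Implicit Types M N : 'M[F]_n.

Definition last_nz M (i j : 'I_n) : bool :=
  (M i j != 0) && [forall k : 'I_n, (i < k)%N ==> (M k j == 0)].

Definition CE1 M : bool :=
  [forall j : 'I_n, forall k : 'I_n,
    (col j M == 0) && (col k M != 0) ==> (k < j)%N].

(* Columns j and k = j + 1 are adjacent; having a last nonzero entry expresses
   that both are nonzero. *)
Definition CE2 M : bool :=
  [forall j : 'I_n, forall k : 'I_n, forall i : 'I_n, forall i' : 'I_n,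
    [&& val k == (val j).+1, last_nz M i j & last_nz M i' k] ==> (i' < i)%N].

Definition CE3 M : bool :=
  [forall i : 'I_n, forall j : 'I_n, last_nz M i j ==>
    (M i j == 1) && [forall k : 'I_n, (k != j) ==> (M i k == 0)]].

Definition reduced_rev_col_echelon M : bool := [&& CE1 M, CE2 M & CE3 M].

Definition Piv M : {set pos n} := maxelems [set x : pos n | M x.1 x.2 != 0].

End EchelonForms.

Definition Oset (F : fieldType) (n : nat) (alpha : {set pos n}) :
    {pred 'M[F]_n} :=
  [pred M | reduced_rev_col_echelon M && (Piv M == alpha)].

Arguments Oset F {n} alpha.

Notation Orep F alpha := {M | M \in Oset F alpha}.

Section IndexPoset.
Context {n : nat}.
Implicit Type alpha : {set pos n}.

Definition Dset alpha : {set pos n} :=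
  [set x in Down alpha | [forall k : 'I_n, ((x.1, k) : pos n) \notin alpha]].

Definition Dpos alpha : Type := {x : pos n | x \in Dset alpha}.

Fact Dpos_display : Order.disp_t. Proof. exact: Order.Disp tt tt. Qed.

HB.instance Definition _ alpha := SubFinite.on (Dpos alpha).
HB.instance Definition _ alpha :=
  [SubChoice_isSubPOrder of Dpos alpha by <: with Dpos_display].

End IndexPoset.

Section Scheme.
Local Open Scope ring_scope.
Context {F : fieldType} {n : nat} {alpha : {set pos n}}.

Definition scheme_rel (beta : {set Dpos alpha}) (M N : 'M[F]_n) : bool :=
  [&& M \in Oset F alpha, N \in Oset F alpha
    & Piv (M - N) == [set val x | x in beta]].

Definition coords (M : Orep F alpha) : {ffun Dpos alpha -> F} :=
  [ffun x => val M (val x).1 (val x).2].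

End Scheme.

(* Main.v *)
(* The whole theorem rests on one description of the echelon matrices with pivot
   set [alpha]: they are exactly the matrices equal to 1 on [alpha] and to 0 off
   [alpha :|: Dset alpha], with arbitrary entries on [Dset alpha].  Hence the
   difference of two of them is supported on [Dset alpha], and its maximal
   support is an anti-chain [beta] iff
   [beta \subset supp \subset beta :|: Down beta]. *)

Require Import Defs.
From HB Require Import structures.
From mathcomp Require Import all_boot all_order all_algebra.

Set Implicit Arguments.
Unset Strict Implicit.
Unset Printing Implicit Defensive.

Import Order.TTheory GRing.Theory.

(** * Maximal elements in a finite poset *)

Section MaximalElements.
Local Open Scope order_scope.
Context {d : Order.disp_t} {X : finPOrderType d}.
Implicit Types (S Y : {set X}) (x y : X).

Lemma antichainP Y :
  reflect {in Y &, forall x y, x <= y -> x = y} (antichain Y).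
Proof.
apply: (iffP forall_inP) => [anti x y xY yY le_xy | anti x xY].
  apply/eqP/negPn/negP => nxy.
  by have /forall_inP/(_ y yY) := anti x xY; rewrite nxy /= /(_ >< _) le_comparable.
apply/forall_inP => y yY; apply/implyP => nxy.
apply/negP => /orP[/anti | /anti] exy; first by rewrite exy ?eqxx in nxy.
by rewrite exy ?eqxx in nxy.
Qed.

Lemma DownP Y x : reflect (exists2 y, y \in Y & x < y) (x \in Down Y).
Proof. by rewrite inE; apply: exists_inP. Qed.

Lemma maxelemsP S x :
  reflect (x \in S /\ {in S, forall y, ~~ (x < y)}) (x \in maxelems S).
Proof.
rewrite inE; apply: (iffP andP) => -[xS mx]; split=> //; first exact/forall_inP.
exact/forall_inP.
Qed.

Lemma mem_UDown Y x : reflect (exists2 y, y \in Y & x <= y) (x \in Y :|: Down Y).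
Proof.
rewrite in_setU; apply: (iffP orP) => [[xY | /DownP[y yY /ltW]] | [y yY]].
- by exists x.
- by exists y.
- rewrite le_eqVlt => /predU1P[-> | lt_xy]; first by left.
  by right; apply/DownP; exists y.
Qed.

(** Among the elements of [S] above [x], one with the largest principal down-set is maximal:
    anything of [S] strictly above it would have a strictly larger down-set. *)
Lemma maxelems_above S x : x \in S -> exists2 y, y \in maxelems S & x <= y.
Proof.
move=> xS.
case: (@arg_maxnP _ x [pred y | (y \in S) && (x <= y)]
         (fun y => #|[set z | z <= y]|)) => [|y /andP[yS le_xy] ymax].
  by rewrite /= xS lexx.
exists y => //; apply/maxelemsP; split=> // w wS; apply/negP => lt_yw.
have /ymax : [pred y | (y \in S) && (x <= y)] w.
  by rewrite /= wS (le_trans le_xy (ltW lt_yw)).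
apply/negP; rewrite -ltnNge; apply/proper_card/properP; split.
  by apply/subsetP => z; rewrite !inE => /le_trans -> //; apply: ltW.
by exists w; rewrite !inE ?lexx // lt_geF.
Qed.

(** Every element of a finite set lies below a maximal one, which gives the second inclusion.
    Conversely, an [x] in [Y] strictly below an element of [S] would lie strictly below an element
    of [Y]. *)
Lemma maxelems_eqP S Y : antichain Y ->
  reflect (Y \subset S /\ S \subset Y :|: Down Y) (maxelems S == Y).
Proof.
move=> /antichainP anti; apply: (iffP eqP) => [<- | [YS SY]].
  split; apply/subsetP => x; first by case/maxelemsP.
  by case/maxelems_above=> y ymax le_xy; apply/mem_UDown; exists y.
apply/setP => x; apply/maxelemsP/idP => [[xS xmax] | xY].
  have /setUP[// | /DownP[y yY lt_xy]] := subsetP SY x xS.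
  by have := xmax y (subsetP YS y yY); rewrite lt_xy.
split; first exact: subsetP YS x xY.
move=> y /(subsetP SY)/mem_UDown[z zY le_yz]; apply/negP => lt_xy.
have lt_xz := lt_le_trans lt_xy le_yz.
by have := lt_xz; rewrite (anti x z xY zY (ltW lt_xz)) ltxx.
Qed.

End MaximalElements.

Section EchelonMatrices.
Local Open Scope ring_scope.
Context {F : fieldType} {n m : nat} {alpha : {set pos n}}.
Hypotheses (alpha_anti : antichain alpha) (m_le_n : (m <= n)%N).
Hypotheses (alpha_card : #|alpha| = m).
Hypothesis alpha_cols : forall x, x \in alpha -> (x.2 < m)%N.
Implicit Types M N : 'M[F]_n.

(** * The staircase shape of [alpha] *)

Lemma antichain_col_inj (i i' j : 'I_n) :
  (i, j) \in alpha -> (i', j) \in alpha -> i = i'.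
Proof.
have /antichainP anti := alpha_anti => ij i'j.
wlog le_ii' : i i' ij i'j / (i <= i')%N.
  by case/orP: (leq_total i i') => h H; [|symmetry]; exact: H.
by have [] : ((i, j) : pos n) = (i', j) by apply: anti; rewrite // leEprod /= lexx andbT.
Qed.

Lemma antichain_row_inj (i j j' : 'I_n) :
  (i, j) \in alpha -> (i, j') \in alpha -> j = j'.
Proof.
have /antichainP anti := alpha_anti => ij ij'.
wlog le_jj' : j j' ij ij' / (j <= j')%N.
  by case/orP: (leq_total j j') => h H; [|symmetry]; exact: H.
by have [] : ((i, j) : pos n) = (i, j') by apply: anti; rewrite // leEprod /= lexx.
Qed.

(** Otherwise the two positions would be comparable. This staircase is what yields [CE2]. *)
Lemma antichain_rows_decr (i i' j j' : 'I_n) :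
  (i, j) \in alpha -> (i', j') \in alpha -> (j < j')%N -> (i' < i)%N.
Proof.
have /antichainP anti := alpha_anti => ij ij' lt_jj'.
rewrite ltnNge; apply/negP => le_ii'.
have [_ ejj'] : ((i, j) : pos n) = (i', j').
  by apply: anti; rewrite // leEprod /=; apply/andP; split=> //; apply: ltnW.
by rewrite ejj' ltnn in lt_jj'.
Qed.

(* Pigeonhole: an anti-chain meets each column at most once. *)
Lemma antichain_col_surj (j : 'I_n) :
  (j < m)%N -> exists i, (i, j) \in alpha.
Proof.
move=> lt_jm; pose C := [set k : 'I_n | (k < m)%N].
have cardC : (#|C| <= m)%N.
  have -> : C = widen_ord m_le_n @: setT.
    apply/setP => k; rewrite inE; apply/idP/imsetP => [lt_km | [k' _ ->]].
      by exists (Ordinal lt_km) => //; apply: val_inj.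
    exact: (ltn_ord k').
  by apply: leq_trans (leq_imset_card _ _) _; rewrite cardsT card_ord.
have /eqP/setP/(_ j) : [set x.2 | x : pos n in alpha] == C.
  rewrite eqEcard card_in_imset ?alpha_card ?cardC ?andbT.
    by apply/subsetP => _ /imsetP[x xa ->]; rewrite inE alpha_cols.
  move=> [i k] [i' k'] /= ik i'k' ekk'; rewrite -ekk' in i'k' *.
  by rewrite (antichain_col_inj ik i'k').
by rewrite inE lt_jm => /imsetP[[i k] ik /= ->]; exists i.
Qed.

Lemma Dset_notin_row (i j k : 'I_n) :
  (i, j) \in Dset alpha -> (i, k) \notin alpha.
Proof. by rewrite inE => /andP[_ /forallP/(_ k)]. Qed.

Lemma Dset_UDown (x : pos n) : x \in alpha :|: Dset alpha -> x \in alpha :|: Down alpha.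
Proof. by rewrite !in_setU !inE => /orP[-> | /andP[-> _]]; rewrite ?orbT. Qed.

(** A position below some [(k, l)] in [alpha] has [j <= l < m], so column [j] has its own pivot;
    since pivot rows decrease to the right, that pivot has row index at least [k]. *)
Lemma UDown_below (i j : 'I_n) :
  (i, j) \in alpha :|: Down alpha -> exists2 i', (i', j) \in alpha & (i <= i')%N.
Proof.
case/mem_UDown=> -[k l] kl; rewrite leEprod /= => /andP[le_ik le_jl].
have [i' i'j] := antichain_col_surj (leq_ltn_trans le_jl (alpha_cols kl)).
exists i' => //; apply: leq_trans le_ik _; move: le_jl.
rewrite leEord leq_eqVlt => /orP[/eqP/val_inj ejl | lt_jl].
  by rewrite (antichain_col_inj kl (i' := i')) -?ejl.
exact/ltnW/antichain_rows_decr/lt_jl.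
Qed.

(** * Echelon matrices described by their entries *)

Lemma last_nz_unique M (i i' j : 'I_n) :
  last_nz M i j -> last_nz M i' j -> i = i'.
Proof.
case/andP=> nz /forallP z /andP[nz' /forallP z'].
by have [lt|lt|/val_inj//] := ltngtP i i';
  [have /implyP/(_ lt) := z i' | have /implyP/(_ lt) := z' i];
  rewrite ?(negPf nz) ?(negPf nz').
Qed.

Definition pivot_form M : Prop :=
  (forall i j : 'I_n, (i, j) \in alpha -> M i j = 1) /\
  (forall i j : 'I_n, (i, j) \notin alpha :|: Dset alpha -> M i j = 0).

Lemma pivot_form_supp M (i j : 'I_n) :
  pivot_form M -> M i j != 0 -> (i, j) \in alpha :|: Dset alpha.
Proof. by case=> _ M0 nz; apply: contraNT nz => /M0 ->. Qed.

(** Nonzero entries of column [j] sit at or above the unique position of [alpha] in that column,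
    where the entry is 1; that position is therefore the last nonzero one. *)
Lemma pivot_form_last_nz M (i j : 'I_n) :
  pivot_form M -> last_nz M i j -> (i, j) \in alpha.
Proof.
move=> pM last_ij; have [nz _] := andP last_ij.
have [i' i'j _] := UDown_below (Dset_UDown (pivot_form_supp pM nz)).
rewrite (last_nz_unique last_ij (i' := i')) // /last_nz (proj1 pM) // oner_eq0 /=.
apply/forallP => k; apply/implyP => lt_i'k; apply: contraLR lt_i'k => nzk.
have [k' k'j] := UDown_below (Dset_UDown (pivot_form_supp pM nzk)).
by rewrite (antichain_col_inj k'j i'j) -leqNgt.
Qed.

Lemma OsetP M : reflect (pivot_form M) (M \in Oset F alpha).
Proof.
rewrite inE; apply: (iffP andP) => [[/and3P[_ _ ce3] /eqP pivM] | pM].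
  (* Entries further down a column occupy larger positions, so a maximal position of the support
     ends its column. *)
  have last_alpha i j : (i, j) \in alpha -> last_nz M i j.
    rewrite -{1}pivM => /maxelemsP[]; rewrite inE /= => nz mx.
    rewrite /last_nz nz; apply/forallP => k; apply/implyP => lt_ik.
    apply/negPn/negP => nzk; have := mx (k, j); rewrite inE /= => /(_ nzk).
    by rewrite ltEprod /= lexx andbT xpair_eqE leEord (ltnW lt_ik) -val_eqE /= ltn_eqF.
  have ce3P i j := implyP (forallP (forallP ce3 i) j).
  split=> [i j ij | i j].
    by have /andP[/eqP] := ce3P i j (last_alpha i j ij).
  rewrite in_setU negb_or => /andP[ija ijD]; apply/eqP/negPn/negP => nz.
  have : ((i, j) : pos n) \in [set x : pos n | M x.1 x.2 != 0] by rewrite inE.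
  case/maxelems_above=> y; rewrite -/(Piv M) pivM => ya le_y.
  have /setUP[ija' | ijDown] : ((i, j) : pos n) \in alpha :|: Down alpha.
  - by apply/mem_UDown; exists y.
  - by rewrite ija' in ija.
  (* The position is in [Down alpha] but not in [Dset alpha], so its row contains a pivot, and [CE3]
     clears the rest of that row. *)
  move: ijD; rewrite inE ijDown /= => /forallPn[k /negPn ik].
  have /andP[_ /forallP/(_ j)/implyP] := ce3P i k (last_alpha i k ik).
  by rewrite (negPf nz) => /(_ _)/negP; apply=> //; apply: contraNneq ija => ->.
have [M1 M0] := pM; split; first apply/and3P; first split.
(* [CE1]: a nonzero column [k] carries a pivot, so [k < m]; every column [j <= k] then carries a
   pivot too and is nonzero. *)
- apply/forallP => j; apply/forallP => k; apply/implyP => /andP[/eqP j0].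
  apply: contraNT; rewrite -leqNgt => le_jk; apply/eqP/matrixP => i u.
  rewrite !mxE; apply/eqP/negPn/negP => nz.
  have [i' i'k _] := UDown_below (Dset_UDown (pivot_form_supp pM nz)).
  have [i'' i''j] := antichain_col_surj (leq_ltn_trans le_jk (alpha_cols i'k)).
  have /colP/(_ i'') := j0; rewrite !mxE M1 // => /eqP.
  by rewrite oner_eq0.
- apply/forallP => j; apply/forallP => k; apply/forallP => i; apply/forallP => i'.
  apply/implyP => /and3P[/eqP ekj li li'].
  apply: (antichain_rows_decr (pivot_form_last_nz pM li) (pivot_form_last_nz pM li')).
  by rewrite [X in (_ < X)%N]ekj.
- apply/forallP => i; apply/forallP => j; apply/implyP => /(pivot_form_last_nz pM) ij.
  rewrite M1 // eqxx; apply/forallP => k; apply/implyP => nkj.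
  (* [alpha] meets row [i] only once, and [Dset alpha] avoids every row that meets [alpha]. *)
  rewrite M0 // in_setU negb_or; apply/andP; split.
    by apply: contra nkj => /antichain_row_inj/(_ ij) ->.
  by apply: contraL ij => /Dset_notin_row.
apply/maxelems_eqP => //; split; apply/subsetP => -[i j]; rewrite inE /=.
  by move=> ij; rewrite M1 ?oner_eq0.
by move=> /(pivot_form_supp pM); apply: Dset_UDown.
Qed.

(** The inverse of [coords]: [insub] succeeds exactly on [Dset alpha], and the default 0 fills the
    positions outside [alpha] and [Dset alpha]. *)
Definition pivot_matrix (f : {ffun Dpos alpha -> F}) : 'M[F]_n :=
  \matrix_(i, j) if (i, j) \in alpha then 1
                 else oapp f 0 (insub ((i, j) : pos n) : option (Dpos alpha)).

Lemma pivot_matrix_Oset f : pivot_matrix f \in Oset F alpha.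
Proof.
apply/OsetP; split=> i j; rewrite !mxE; first by move=> ->.
by rewrite in_setU negb_or => /andP[/negPf-> nD]; rewrite insubN.
Qed.

Lemma coords_bij : bijective (@coords F n alpha).
Proof.
exists (fun f => Sub (pivot_matrix f) (pivot_matrix_Oset f) : Orep F alpha) => [[M MO] | f].
  apply: val_inj; apply/matrixP => i j; rewrite /= mxE.
  have [M1 M0] := OsetP _ MO.
  case: ifPn => [/M1 // | ija]; case: insubP => [x _ ex | nD] /=.
    by rewrite ffunE ex.
  by rewrite M0 // in_setU negb_or ija nD.
apply/ffunP => -[[i j] ijD]; rewrite ffunE /= mxE.
by rewrite (negPf (Dset_notin_row _ ijD)) (insubT (mem (Dset alpha)) ijD).
Qed.

(** Both matrices are 1 on [alpha] and 0 off [alpha :|: Dset alpha], so they differ only inside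
    [Dset alpha]; the order there is induced, so maximality may be tested in the subtype. *)
Lemma Piv_sub M N : M \in Oset F alpha -> N \in Oset F alpha ->
  Piv (M - N) =
  [set val x | x in maxelems [set x : Dpos alpha | M (val x).1 (val x).2 != N (val x).1 (val x).2]].
Proof.
move=> /OsetP[M1 M0] /OsetP[N1 N0].
have nzE (y : pos n) : ((M - N) y.1 y.2 != 0) = (M y.1 y.2 != N y.1 y.2).
  by rewrite !mxE subr_eq0.
have suppD (y : pos n) : M y.1 y.2 != N y.1 y.2 -> y \in Dset alpha.
  case: y => i j /=; apply: contraNT => nD.
  have [ija | nija] := boolP (((i, j) : pos n) \in alpha); first by rewrite M1 ?N1.
  by rewrite M0 ?N0 // in_setU negb_or nija.
apply/setP => y; apply/maxelemsP/imsetP => [[] | [x /maxelemsP[]]].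
  rewrite inE nzE => neq_y ymax; pose x : Dpos alpha := Sub y (suppD y neq_y).
  exists x => //; apply/maxelemsP; rewrite inE; split=> // z; rewrite inE -nzE => neq_z.
  by rewrite ltEsub; apply: ymax; rewrite inE.
rewrite inE => neq_x xmax ->; rewrite inE nzE; split=> // z; rewrite inE nzE => neq_z.
by rewrite -[z](SubK (Dpos alpha) (suppD z neq_z)) -ltEsub xmax // inE.
Qed.

(** By [maxelems_eqP] for the set of disagreements: its first inclusion is disagreement on [beta],
    and the contrapositive of its second is agreement off [beta :|: Down beta]. *)
Lemma scheme_relP (beta : {set Dpos alpha}) M N :
  M \in Oset F alpha -> N \in Oset F alpha -> antichain beta ->
  scheme_rel beta M N <->
  (forall x : Dpos alpha, x \notin beta :|: Down beta ->
     M (val x).1 (val x).2 = N (val x).1 (val x).2) /\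
  (forall x : Dpos alpha, x \in beta ->
     M (val x).1 (val x).2 <> N (val x).1 (val x).2).
Proof.
move=> MO NO anti.
rewrite /scheme_rel MO NO /= Piv_sub // (inj_eq (imset_inj val_inj)).
split=> [/(maxelems_eqP _ anti)[/subsetP sub1 /subsetP sub2] | [agree differ]].
  split=> x; first by move=> nx; apply/eqP; apply: contraNT nx => neq; apply: sub2; rewrite inE.
  by move=> /sub1; rewrite inE => /eqP.
apply/(maxelems_eqP _ anti); split; apply/subsetP => x.
  by move=> /differ/eqP; rewrite inE.
by rewrite inE; apply: contraNT => /agree ->.
Qed.

End EchelonMatrices.

Theorem theorem4p2 (F : fieldType) (n m : nat) (alpha : {set pos n})
  (n_ge1 : (1 <= n)%N) (m_range : (1 <= m <= n - 1)%N)
  (alpha_anti : antichain alpha) (alpha_card : #|alpha| = m)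
  (alpha_cols : forall x, x \in alpha -> (x.2 < m)%N) :
  [/\ bijective (@coords F n alpha),
      (forall (beta : {set Dpos alpha}) (M N : Orep F alpha),
         antichain beta ->
         scheme_rel beta (val M) (val N) <->
         (forall x : Dpos alpha, x \notin beta :|: Down beta ->
            val M (val x).1 (val x).2 = val N (val x).1 (val x).2) /\
         (forall x : Dpos alpha, x \in beta ->
            val M (val x).1 (val x).2 <> val N (val x).1 (val x).2))
    & (forall (beta : {set Dpos alpha}) (i : Dpos alpha -> 'I_2)
              (M N : Orep F alpha),
         wreath_label (r := fun=> 1%N) beta i ->
         scheme_rel beta (val M) (val N) <->
         wreath_rel (r := fun=> 1%N) (Omega := fun=> F)
           (fun=> @one_class_rel F) beta i (coords M) (coords N))].
Proof.
have m_le_n : (m <= n)%N.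
  by case/andP: m_range => _ /leq_trans -> //; apply: leq_subr.
have schemeP (beta : {set Dpos alpha}) (M N : Orep F alpha) :=
  scheme_relP alpha_anti m_le_n alpha_card alpha_cols (beta := beta) (valP M) (valP N).
split; first exact: coords_bij alpha_anti m_le_n alpha_card alpha_cols.
  by move=> beta M N; apply: schemeP.
move=> beta i M N [anti i_neq0]; apply: iff_trans (schemeP beta M N anti) _.
(* A nonzero index in ['I_2] selects disequality, so only [coords] remains to be unfolded. *)
split=> -[agree differ]; split=> x xb.
- by rewrite !ffunE agree.
- by rewrite /one_class_rel (negPf (i_neq0 x xb)) !ffunE; apply: differ.
- by have := agree x xb; rewrite !ffunE.
- by have := differ x xb; rewrite /one_class_rel (negPf (i_neq0 x xb)) !ffunE.
Qed.
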